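(* Let $D\subseteq\mathbb{R}^n$ be nonempty, convex and closed, let $f:\mathbb{R}^n\to\mathbb{R}$ be continuously differentiable on $D$ (i.e. on an open set containing $D$), and put $f^*=\inf_{x\in D}f(x)$. Let $\gamma>f^*$ be a number such that $D_\gamma=\{x\in D:f(x)\le\gamma\}$ is bounded. Let $D^*=\{x\in D:f(x)=f^*\}$ and $D^0=\{x^*\in D:\langle\nabla f(x^* ),x-x^*\rangle\ge0\ \forall x\in D\}$. Let $\alpha>0$ and let $\beta\in(0,1)$ with $\beta<\alpha$. Apply Method (GPMS) (described in the context) with these data, and let $\{x^k\}$ be the points it generates. Then: (i) If the method terminates at some iteration $k$, then $x^k\in D^0$. (ii) If the method does not terminate, the infinite sequence $\{x^k\}$ has a limit point which belongs to $D^0$. (iii) If the method does not terminate and $D^*=D^0$, then all the limit points of $\{x^k\}$ belong to $D^*$ and $\lim_{k\to\infty}f(x^k)=f^*$.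
   Context: $\pi_D$ denotes the Euclidean projection onto $D$. A limit point of a sequence is a limit of some subsequence. For fixed $\alpha>0$ set $y_\alpha(x)=\pi_D[x-\alpha^{-1}\nabla f(x)]$ for $x\in D$. Method (GPMS), for data $D,f,\gamma,\alpha,\beta$: Step 0. Choose $x^0\in D_\gamma$, $\beta\in(0,1)$, and a sequence $\{\tau_l\}_{l\ge0}$ with $\tau_l\in(0,1)$ and $\tau_l\to0$. Set $k=0$, $l=0$, $u^0=x^0$, and choose $\lambda_0\in(0,\tau_0]$. Step 1. Set $y^k=y_\alpha(x^k)$. If $y^k=x^k$, stop (termination). Otherwise set $d^k=y^k-x^k$ and $z^{k+1}=x^k+\lambda_kd^k$. Step 2. If $f(z^{k+1})\le f(x^k)-\beta\lambda_k\|d^k\|^2$, choose any $\lambda_{k+1}\in[\lambda_k,\tau_l]$ (with $l$ unchanged), set $x^{k+1}=z^{k+1}$ and go to Step 4. Step 3. (Otherwise.) Set $\lambda'_{k+1}=\min\{\lambda_k,\tau_{l+1}\}$, then replace $l$ by $l+1$, and choose any $\lambda_{k+1}\in(0,\lambda'_{k+1}]$. If $f(z^{k+1})\le\gamma$, set $x^{k+1}=z^{k+1}$ and go to Step 4. Otherwise set $x^{k+1}=u^k$, $u^{k+1}=u^k$, replace $k$ by $k+1$ and go to Step 1. Step 4. If $f(x^{k+1})<f(u^k)$, set $u^{k+1}=x^{k+1}$; otherwise set $u^{k+1}=u^k$. Replace $k$ by $k+1$ and go to Step 1. Thus $u^k$ is a best point so far: $f(u^k)=\min_{0\le i\le k}f(x^i)$.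 *)

(* Defs.v *)
From HB Require Import structures.
From mathcomp Require Import all_boot all_order all_algebra.
From mathcomp Require Import all_classical all_reals all_analysis.

Set Implicit Arguments.
Unset Strict Implicit.
Unset Printing Implicit Defensive.

Import Order.TTheory GRing.Theory Num.Theory.
Import numFieldNormedType.Exports.

Local Open Scope classical_set_scope.
Local Open Scope ring_scope.

(* The library's norm on 'rV[R]_n is the sup norm; topology, boundedness and
   differentiability do not depend on the choice of norm, but the projection
   and the descent test do, so the Euclidean norm is defined here. *)
Definition inner (R : realType) (n : nat) (u v : 'rV[R]_n) : R :=
  \sum_(i < n) u 0 i * v 0 i.

Definition enorm (R : realType) (n : nat) (u : 'rV[R]_n) : R :=
  Num.sqrt (inner u u).

Definition grad (R : realType) (n : nat) (f : 'rV[R]_n -> R) (x : 'rV[R]_n) :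
    'rV[R]_n :=
  \row_(i < n) 'D_(delta_mx 0 i) f x.

Definition continuously_differentiable_on (R : realType) (n : nat)
    (D : set 'rV[R]_n) (f : 'rV[R]_n -> R) : Prop :=
  exists U : set 'rV[R]_n,
    [/\ open U, D `<=` U, {in U, forall x, differentiable f x}
      & {in U, continuous (grad f)}].

(* [get] picks the nearest point, which exists and is unique when D is
   nonempty, closed and convex. *)
Definition proj (R : realType) (n : nat) (D : set 'rV[R]_n) (x : 'rV[R]_n) :
    'rV[R]_n :=
  get [set p | D p /\ forall q, D q -> enorm (x - p) <= enorm (x - q)].

(* Extended-real valued, so that no default value enters when f is unbounded
   below on D. *)
Definition inf_val (R : realType) (n : nat) (D : set 'rV[R]_n)
    (f : 'rV[R]_n -> R) : \bar R :=
  ereal_inf [set (f x)%:E | x in D].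

Definition sublevel (R : realType) (n : nat) (D : set 'rV[R]_n)
    (f : 'rV[R]_n -> R) (gamma : R) : set 'rV[R]_n :=
  [set x | D x /\ f x <= gamma].

Definition minimizers (R : realType) (n : nat) (D : set 'rV[R]_n)
    (f : 'rV[R]_n -> R) : set 'rV[R]_n :=
  [set x | D x /\ (f x)%:E = inf_val D f].

Definition stationary (R : realType) (n : nat) (D : set 'rV[R]_n)
    (f : 'rV[R]_n -> R) : set 'rV[R]_n :=
  [set x | D x /\ forall y, D y -> 0 <= inner (grad f x) (y - x)].

Definition seq_limit_point (R : realType) (n : nat) (x : nat -> 'rV[R]_n)
    (a : 'rV[R]_n) : Prop :=
  exists2 phi : nat -> nat, increasing_seq phi & x \o phi @ \oo --> a.

Definition y_map (R : realType) (n : nat) (D : set 'rV[R]_n)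
    (f : 'rV[R]_n -> R) (alpha : R) (x : 'rV[R]_n) : 'rV[R]_n :=
  proj D (x - alpha^-1 *: grad f x).

(* The values x^k, u^k, lambda_k and the current l at the start of
   iteration k. *)
Record gpms_state (R : realType) (n : nat) := GpmsState {
  iterate : 'rV[R]_n;
  record_pt : 'rV[R]_n;
  stepsize : R;
  level : nat }.

Definition gpms_init (R : realType) (n : nat) (D : set 'rV[R]_n)
    (f : 'rV[R]_n -> R) (gamma : R) (tau : nat -> R)
    (s : gpms_state R n) : Prop :=
  [/\ sublevel D f gamma (iterate s),
      record_pt s = iterate s,
      level s = 0%N
    & 0 < stepsize s <= tau 0%N].

Definition update_record (R : realType) (n : nat) (f : 'rV[R]_n -> R)
    (u x : 'rV[R]_n) : 'rV[R]_n :=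
  if f x < f u then x else u.

(* One non-terminating iteration, from the state s to the state s'. It is a
   relation because the new stepsize is a free choice. *)
Definition gpms_step (R : realType) (n : nat) (D : set 'rV[R]_n)
    (f : 'rV[R]_n -> R) (gamma alpha beta : R) (tau : nat -> R)
    (s s' : gpms_state R n) : Prop :=
  let x := iterate s in
  let u := record_pt s in
  let lambda := stepsize s in
  let l := level s in
  let d := y_map D f alpha x - x in
  let z := x + lambda *: d in
  y_map D f alpha x <> x /\
  if f z <= f x - beta * lambda * enorm d ^+ 2 then
    [/\ lambda <= stepsize s' <= tau l,
        level s' = l,
        iterate s' = z
      & record_pt s' = update_record f u z]
  else
    [/\ 0 < stepsize s' <= Num.min lambda (tau l.+1),
        level s' = l.+1
      & if f z <= gamma then
          iterate s' = z /\ record_pt s' = update_record f u z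
        else
          iterate s' = u /\ record_pt s' = u].

(* A run stopped at iteration k; the states of index > k are irrelevant. *)
Definition gpms_terminates_at (R : realType) (n : nat) (D : set 'rV[R]_n)
    (f : 'rV[R]_n -> R) (gamma alpha beta : R) (tau : nat -> R)
    (s : nat -> gpms_state R n) (k : nat) : Prop :=
  [/\ gpms_init D f gamma tau (s 0%N),
      forall i, (i < k)%N ->
        gpms_step D f gamma alpha beta tau (s i) (s i.+1)
    & y_map D f alpha (iterate (s k)) = iterate (s k)].

Definition gpms_infinite_run (R : realType) (n : nat) (D : set 'rV[R]_n)
    (f : 'rV[R]_n -> R) (gamma alpha beta : R) (tau : nat -> R)
    (s : nat -> gpms_state R n) : Prop :=
  gpms_init D f gamma tau (s 0%N) /\
  forall k, gpms_step D f gamma alpha beta tau (s k) (s k.+1).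

(* Main.v *)
Require Import Defs.
From HB Require Import structures.
From mathcomp Require Import all_boot all_order all_algebra.
From mathcomp Require Import all_classical all_reals all_analysis.
From mathcomp Require Import ring lra.

Import Order.TTheory GRing.Theory Num.Theory.
Import numFieldNormedType.Exports.

Local Open Scope classical_set_scope.
Local Open Scope ring_scope.

(** Write y = y_alpha for the projected gradient map and d(x) = y(x) - x. The
    obtuse-angle property of the projection gives
    <grad f(x), q - y(x)> >= alpha <x - y(x), q - y(x)> for all q in D
    ([y_map_obtuse]). Hence a fixed point of y is stationary, which is the
    claim about termination, and d(x) is a descent direction with
    <grad f(x), d(x)> <= - alpha |d(x)|^2 ([y_map_descent]). Since the
    projection is nonexpansive, y is continuous on D.

    All iterates stay in the bounded set D_gamma, so subsequences of them
    converge ([bounded_subsequence]). Two arguments show that a limit a is a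
    fixed point of y, according to how often the descent test fails.

    If it fails infinitely often, the level l tends to infinity, so the
    stepsizes, which are at most tau_l, tend to 0 ([run_stepsize_cvg0]).
    Along the failing iterations the mean value theorem turns the failure into
    <grad f(xi_k), d_k> > - beta |d_k|^2 at a point xi_k between x^k and the
    trial point. In the limit <grad f(a), d(a)> >= - beta |d(a)|^2, and with
    the descent property (alpha - beta) |d(a)|^2 <= 0
    ([fixed_of_failed_decrease]).

    If it fails finitely often, then from some iteration on f(x^k) is
    nonincreasing and the stepsizes are bounded below. As f(x^k) tends to f(a)
    along the subsequence, the decreases beta lambda_k |d_k|^2 tend to 0
    there, so d(a) = 0 ([fixed_of_sufficient_decrease]).

    Let now every stationary point have the minimal value m, and let e > 0.
    After a failed test the next iterate is either the trial point, whose
    distance to x^k vanishes, or a record point, which has no larger value than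
    x^k; as x^k accumulates at stationary points along the failing iterations,
    f(x^(k+1)) < m + e after every late failure. A successful test does not
    increase f. So once a late iterate has a value below m + e, which happens
    because some limit point is stationary, all later ones do
    ([run_value_cvg]). *)

Set Implicit Arguments.
Unset Strict Implicit.
Unset Printing Implicit Defensive.

(** * Euclidean inner product *)

Section InnerProduct.
Context {R : realType} {n : nat}.
Implicit Types u v w : 'rV[R]_n.

Lemma innerC u v : inner u v = inner v u.
Proof. by apply: eq_bigr => i _; rewrite mulrC. Qed.

Lemma innerDl u v w : inner (u + v) w = inner u w + inner v w.
Proof. by rewrite /inner -big_split; apply: eq_bigr => i _; rewrite mxE mulrDl. Qed.

Lemma innerZl t u w : inner (t *: u) w = t * inner u w.
Proof. by rewrite /inner mulr_sumr; apply: eq_bigr => i _; rewrite mxE mulrA. Qed.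

Lemma innerDr u v w : inner w (u + v) = inner w u + inner w v.
Proof. by rewrite innerC innerDl !(innerC w). Qed.

Lemma innerZr t u w : inner w (t *: u) = t * inner w u.
Proof. by rewrite innerC innerZl innerC. Qed.

Lemma innerNl u w : inner (- u) w = - inner u w.
Proof. by rewrite -scaleN1r innerZl mulN1r. Qed.

Lemma innerNr u w : inner w (- u) = - inner w u.
Proof. by rewrite innerC innerNl innerC. Qed.

Definition innerE := (innerDl, innerDr, innerNl, innerNr, innerZl, innerZr).

Lemma inner_subr_sqr u v :
  inner (u - v) (u - v) = inner u u - 2 * inner u v + inner v v.
Proof. rewrite !innerE (innerC v u); ring. Qed.

Lemma inner0l u : inner 0 u = 0.
Proof. by have := innerZl 0 0 u; rewrite scale0r mul0r. Qed.

Lemma inner_ge0 u : 0 <= inner u u.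
Proof. by apply: sumr_ge0 => i _; rewrite -expr2 sqr_ge0. Qed.

Lemma enorm_sqr u : enorm u ^+ 2 = inner u u.
Proof. by rewrite sqr_sqrtr ?inner_ge0. Qed.

Lemma enorm_le u v : (enorm u <= enorm v) = (inner u u <= inner v v).
Proof. by rewrite ler_sqrt ?inner_ge0. Qed.

Lemma coord_sqr_le_inner u i : u 0 i ^+ 2 <= inner u u.
Proof.
rewrite /inner (bigD1 i)//= -expr2 lerDl.
by apply: sumr_ge0 => j _; rewrite -expr2 sqr_ge0.
Qed.

Lemma inner_le0_eq0 u : inner u u <= 0 -> u = 0.
Proof.
move=> u0; apply/rowP => i; rewrite mxE; apply/eqP.
by rewrite -sqrf_eq0 eq_le sqr_ge0 (le_trans (coord_sqr_le_inner u i)).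
Qed.

(** The topology of row vectors comes from the sup norm; this inequality
    transfers Euclidean estimates to it. *)
Lemma norm_le_enorm u : `|u| <= enorm u.
Proof.
rewrite [`|u|]mx_normrE; apply/bigmax_leP; split; first exact: sqrtr_ge0.
move=> [i j] _ /=; rewrite -sqrtr_sqr ler_wsqrtr// (ord1 i).
exact: coord_sqr_le_inner.
Qed.

Lemma cvg_inner {T : Type} {F : set_system T} {FF : Filter F}
    (u v : T -> 'rV[R]_n) a b :
  u @ F --> a -> v @ F --> b -> inner (u t) (v t) @[t --> F] --> inner a b.
Proof.
move=> ua vb; apply: cvg_big => [|i _]; first exact: add_continuous.
apply: cvgM.
  apply: (@cvg_comp _ _ _ u (fun M : 'rV[R]_n => M 0 i) _ _ _ ua).
  exact: coord_continuous.
apply: (@cvg_comp _ _ _ v (fun M : 'rV[R]_n => M 0 i) _ _ _ vb).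
exact: coord_continuous.
Qed.

End InnerProduct.

Lemma inner_to_cvg {R : realType} {n : nat} {T : Type} {F : set_system T}
    {FF : Filter F} (u : T -> 'rV[R]_n) a :
  inner (u t - a) (u t - a) @[t --> F] --> 0 -> u @ F --> a.
Proof.
move=> ua; apply/cvgrPdist_lt => e e0.
have e20 : 0 < e ^+ 2 by rewrite exprn_gt0.
near=> t; rewrite distrC.
rewrite (le_lt_trans (norm_le_enorm _))// -(ltr_pXn2r (n := 2)) ?nnegrE ?(ltW e0)//.
  by rewrite enorm_sqr; near: t; exact: cvgr_lt ua _ e20.
exact: sqrtr_ge0.
Unshelve. all: by end_near. Qed.

(** * Segments and subsequences *)

Lemma segment_in_convex {R : realType} {n : nat} (D : set 'rV[R]_n) :
  convex_set (D : set (convex_lmodType 'rV[R]_n)) ->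
  forall x y (t : R), D x -> D y -> 0 <= t <= 1 -> D (x + t *: (y - x)).
Proof.
move=> cD x y t Dx Dy /andP[t0 t1].
have := cD y x (Itv01 t0 t1) (mem_set Dy) (mem_set Dx); rewrite inE/=.
congr (D _); rewrite /conv/= /unstable.onem scalerBl scale1r scalerBr.
by rewrite addrCA.
Qed.

(** Bolzano-Weierstrass along the indices satisfying [P]: a cluster point of
    the sequence restricted to [P] is approached by a greedy choice of indices.
    *)
Lemma bounded_subsequence {R : realType} {n : nat} (x : nat -> 'rV[R]_n)
    (P : set nat) :
  bounded_set (range x) -> (forall N, exists2 k, (N <= k)%N & P k) ->
  exists (a : 'rV[R]_n) (phi : nat -> nat),
    [/\ increasing_seq phi, forall j, P (phi j) & x \o phi @ \oo --> a].
Proof.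
move=> xbnd Pinf.
have [M Mx] : exists M : R, forall k, `|x k| <= M.
  case: xbnd => M0 [_ H]; exists (M0 + 1) => k.
  by apply: (H (M0 + 1)); [rewrite ltrDl|exists k].
have cptB : compact [set v : 'rV[R]_n | `|v| <= M].
  apply: bounded_closed_compact.
    by exists M; split; [exact: num_real|move=> N MN v /= /le_trans; apply; exact: ltW].
  apply: (@preimage_closed _ _ (fun v : 'rV[R]_n => `|v|) [set r | r <= M]).
    by move=> v _; exact: norm_continuous.
  exact: closed_le.
have PF : ProperFilter (within P \oo).
  split; last exact: within_filter.
  by case=> N _ NP; have [k Nk Pk] := Pinf N; exact: (NP k).
have [|a [_ acl]] := cptB _ (fmap_proper_filter x PF).
  by exists 0%N => // k _ _; exact: Mx.
(* [jm.1] fixes the accuracy wanted, [jm.2] is the index to be exceeded. *)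
have next (jm : nat * nat) :
    exists k, [/\ (jm.2 < k)%N, P k & `|a - x k| < jm.1.+1%:R^-1].
  have [||v [[k [mk Pk <-]] vb]] := acl [set x k | k in [set k | (jm.2 < k)%N /\ P k]]
    (ball a jm.1.+1%:R^-1).
  - by exists jm.2.+1 => // k /= mk Pk; exists k.
  - by apply: nbhsx_ballx; rewrite invr_gt0.
  - by exists k; split => //; rewrite mx_norm_ball in vb.
have [g gP] := choice next.
pose phi := fix phi j := if j is i.+1 then g (j, phi i) else g (0, 0)%N.
exists a, phi; split.
- by apply/increasing_seqP => j; have [] := gP (j.+1, phi j).
- by case=> [|j]; [have [] := gP (0, 0)%N|have [] := gP (j.+1, phi j)].
- apply/cvgrPdist_lt => e e0.
  near=> j; apply: (@lt_trans _ _ j.+1%:R^-1).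
    by case: (j) => [|i]; [have [] := gP (0, 0)%N|have [] := gP (i.+1, phi i)].
  by near: j; exact: (cvgr_lt _ (@cvg_harmonic R) _ e0).
Unshelve. all: by end_near. Qed.

(** * Projection onto a closed convex set *)

Section Projection.
Context {R : realType} {n : nat} (D : set 'rV[R]_n).
Hypotheses (D_nonempty : D !=set0) (D_closed : closed D).

(** A nearest point exists because the distance to [x] only has to be minimized
    over the compact part of [D] that is no farther from [x] than a given point
    of [D]. *)
Lemma projP x :
  D (Defs.proj D x) /\ forall q, D q -> enorm (x - Defs.proj D x) <= enorm (x - q).
Proof.
apply: (getPex (P := [set p | D p /\ forall q, D q -> enorm (x - p) <= enorm (x - q)])).
have [q0 Dq0] := D_nonempty.
pose h q := inner (x - q) (x - q).
have hc : continuous h.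
  have sc : continuous (fun p : 'rV[R]_n => x - p).
    by move=> q; apply: continuousB; [exact: cst_continuous|exact: id].
  by move=> q; exact: (cvg_inner (sc q) (sc q)).
pose A := [set q | D q /\ h q <= h q0].
have [||c /set_mem[Dc hc0] cmin] := @EVT_min_rV R n h A _ _ (continuous_subspaceT hc).
- by exists q0; split.
- apply: bounded_closed_compact.
    exists (`|x| + enorm (x - q0)); split; first exact: num_real.
    move=> M /ltW MM q [_ hq]; apply: le_trans MM.
    have -> : q = x - (x - q) by rewrite opprB addrC subrK.
    rewrite (le_trans (ler_normB _ _))// lerD2l (le_trans (norm_le_enorm _))//.
    by rewrite enorm_le.
  apply: closedI => //.
  apply: (@preimage_closed _ _ h [set r | r <= h q0]); last exact: closed_le.
  by move=> v _; exact: hc.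
- exists c; split => // q Dq; rewrite enorm_le -/(h c) -/(h q).
  have [hq|hq] := lerP (h q) (h q0); first by apply: cmin; rewrite inE.
  exact: le_trans hc0 (ltW hq).
Qed.

Hypothesis D_convex : convex_set (D : set (convex_lmodType 'rV[R]_n)).

(** Moving from the projection towards [q] by a fraction [t] changes the squared
    distance to [x] by - 2 t c + t^2 N, where c is the inner product below and
    N the squared length of the segment; minimality for small [t] gives c <= 0.
    *)
Lemma proj_obtuse x q : D q -> inner (x - Defs.proj D x) (q - Defs.proj D x) <= 0.
Proof.
move=> Dq; have [Dp pmin] := projP x; set p := Defs.proj D x in Dp pmin *.
set c := inner _ _; pose N := inner (q - p) (q - p).
have key t : 0 < t <= 1 -> 2 * c <= t * N.
  move=> /andP[t0 t1].
  have := pmin _ (segment_in_convex D_convex Dp Dq (introT andP (conj (ltW t0) t1))).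
  rewrite enorm_le opprD addrA (inner_subr_sqr (x - p)) !innerZr innerZl.
  rewrite -/c -/N => pmin_t; rewrite -(ler_pM2l t0); lra.
rewrite leNgt; apply/negP => c0.
(* If c > 0, then [key] fails at t = min(1, c / N). *)
have [Nc|cN] := lerP N c; first by have := key 1; rewrite ltr01 lexx => /(_ isT); lra.
have N0 : 0 < N by apply: lt_trans cN.
have := key (c / N); rewrite divr_gt0// ler_pdivrMr// mul1r (ltW cN) => /(_ isT).
by rewrite divfK ?gt_eqF//; lra.
Qed.

(** Adding the obtuse-angle inequalities at both points gives
    |p - q|^2 <= <x - y, p - q> for the projections p and q; expanding
    |(x - y) - (p - q)|^2 >= 0 then finishes without Cauchy-Schwarz. *)
Lemma proj_nonexpansive x y :
  inner (Defs.proj D x - Defs.proj D y) (Defs.proj D x - Defs.proj D y) <= inner (x - y) (x - y).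
Proof.
have := proj_obtuse x (projP y).1; have := proj_obtuse y (projP x).1.
have := inner_ge0 ((x - y) - (Defs.proj D x - Defs.proj D y)).
set p := Defs.proj D x; set q := Defs.proj D y.
have E : inner (x - p) (q - p) + inner (y - q) (p - q)
   = inner (p - q) (p - q) - inner (x - y) (p - q).
  rewrite !innerE (innerC p q); ring.
rewrite (inner_subr_sqr (x - y)); lra.
Qed.

Lemma projection_continuous : continuous (Defs.proj D).
Proof.
move=> a; apply: (@inner_to_cvg _ _ _ (nbhs a)).
apply: (squeeze_cvgr (f := fun=> 0) (h := fun x => inner (x - a) (x - a))).
- by apply: nearW => x; rewrite inner_ge0 proj_nonexpansive.
- exact: cvg_cst.
- have sc : continuous (fun p : 'rV[R]_n => p - a).
    by move=> p; apply: continuousB; [exact: id|exact: cst_continuous].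
  have := cvg_inner (sc a) (sc a); rewrite subrr.
  by rewrite inner0l; exact.
Qed.

End Projection.

(** * Gradient and mean value theorem *)

Section Gradient.
Context {R : realType} {n : nat} (f : 'rV[R]_n -> R).

Lemma derive_grad x v : differentiable f x -> 'D_v f x = inner (grad f x) v.
Proof.
move=> fx; rewrite deriveE// [in LHS](row_sum_delta v) linear_sum.
by apply: eq_bigr => i _; rewrite linearZ/= mxE mulrC deriveE.
Qed.

Lemma mean_value_grad x v :
  (forall t, 0 <= t <= 1 -> differentiable f (x + t *: v)) ->
  exists2 c, 0 <= c <= 1 & f (x + v) - f x = inner (grad f (x + c *: v)) v.
Proof.
move=> fdiff; pose g (t : R) := f (x + t *: v).
(* The difference quotients of [g] are those of [f] in the direction [v]. *)
have gE (t : R) : (fun h : R => h^-1 *: (g (h *: 1 + t) - g t)) =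
    (fun h => h^-1 *: (f (h *: v + (x + t *: v)) - f (x + t *: v))).
  apply/funext => h; rewrite /g; congr (_ *: (f _ - _)).
  by rewrite scaler1 scalerDl addrCA.
have gder (t : R) : 0 <= t <= 1 -> is_derive t 1 g (inner (grad f (x + t *: v)) v).
  move=> t01; have fdt := fdiff t t01.
  apply: DeriveDef; last by rewrite -derive_grad// /derive/= gE.
  by rewrite /derivable/= gE; exact: diff_derivable.
have [||c c01] := @MVT_segment R g (fun t => inner (grad f (x + t *: v)) v) 0 1 ler01.
- by move=> t; rewrite in_itv/= => /andP[t0 t1]; apply: gder; rewrite !ltW.
- apply: derivable_within_continuous => t; rewrite in_itv/= => t01.
  exact: (@ex_derive _ _ _ _ _ _ _ (gder t t01)).
rewrite subr0 mulr1 /g scale1r scale0r addr0 => fE.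
by exists c => //; move: c01; rewrite in_itv.
Qed.

End Gradient.

(** * The projected gradient map and its fixed points *)

Section ProjectedGradientMap.
Context {R : realType} {n : nat} (D : set 'rV[R]_n) (f : 'rV[R]_n -> R).
Context (alpha : R).
Hypotheses (D_nonempty : D !=set0) (D_closed : closed D).
Hypothesis D_convex : convex_set (D : set (convex_lmodType 'rV[R]_n)).
Hypothesis f_C1 : continuously_differentiable_on D f.
Hypothesis alpha_gt0 : 0 < alpha.
Local Notation y := (y_map D f alpha).

Lemma C1_continuous x : D x -> {for x, continuous f}.
Proof.
have [U [_ DU fU _]] := f_C1 => /DU Ux.
by apply: differentiable_continuous; apply: fU; rewrite inE.
Qed.

Lemma C1_grad_continuous x : D x -> {for x, continuous (grad f)}.
Proof.
by have [U [_ DU _ gU]] := f_C1 => /DU Ux; apply: gU; rewrite inE.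
Qed.

Lemma y_map_in x : D (y x).
Proof. by have [] := projP D_nonempty D_closed (x - alpha^-1 *: grad f x). Qed.

(** The obtuse-angle property of the projection of x - alpha^-1 grad f(x),
    multiplied by alpha; the two lemmas after it are the cases q = x and
    y(x) = x. *)
Lemma y_map_obtuse x q : D q ->
  alpha * inner (x - y x) (q - y x) <= inner (grad f x) (q - y x).
Proof.
move=> Dq; have := proj_obtuse D_nonempty D_closed D_convex (x - alpha^-1 *: grad f x) Dq.
rewrite -/(y x) addrAC (innerDl (x - y x)) (innerNl (alpha^-1 *: _)) innerZl subr_le0.
by rewrite -(ler_pM2l alpha_gt0) mulrA divff ?gt_eqF// mul1r.
Qed.

Lemma y_map_descent x : D x ->
  inner (grad f x) (y x - x) <= - alpha * inner (y x - x) (y x - x).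
Proof.
move=> Dx; have := y_map_obtuse x Dx.
rewrite -opprB !innerNl !innerNr opprK; lra.
Qed.

Lemma y_map_fixed_stationary x : D x -> y x = x -> stationary D f x.
Proof.
move=> Dx yx; split=> // q Dq; have := y_map_obtuse x Dq.
suff -> : inner (x - y x) (q - y x) = 0 by rewrite mulr0 yx.
by rewrite yx subrr inner0l.
Qed.

Lemma y_map_continuous x : D x -> {for x, continuous y}.
Proof.
move=> Dx; have step_cont : {for x, continuous (fun z : 'rV[R]_n => z - alpha^-1 *: grad f z)}.
  apply: continuousB; first exact: id.
  by apply: continuousZl_tmp; exact: C1_grad_continuous.
exact: continuous_comp step_cont (@projection_continuous _ _ _ D_nonempty D_closed D_convex _).
Qed.

(* From here on [x] is a convergent sequence in [D], to be instantiated with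
   subsequences of the iterates, and [lambda] are its stepsizes. *)
Context (x : nat -> 'rV[R]_n) (lambda : nat -> R) (a : 'rV[R]_n) (beta : R).
Hypotheses (Dx : forall k, D (x k)) (xa : x @ \oo --> a).

Let Da : D a.
Proof. by apply: (closed_cvg D D_closed _ _ xa); exact: nearW. Qed.

Let d k := y (x k) - x k.

Let da : d @ \oo --> y a - a.
Proof. by apply: cvgB => //; apply: (cvg_comp _ _ xa); exact: y_map_continuous. Qed.

(** If the trial values do not fall below the value at the limit, the guaranteed
    decreases are at most f(x_k) - f(a), which tends to 0; stepsizes bounded
    below then force d_k to 0. *)
Lemma fixed_of_sufficient_decrease c : 0 < beta -> 0 < c ->
  (forall k, c <= lambda k) ->
  (forall k, f (x k + lambda k *: d k)
     <= f (x k) - beta * lambda k * enorm (d k) ^+ 2) ->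
  (forall k, f a <= f (x k + lambda k *: d k)) ->
  y a = a.
Proof.
move=> beta0 c0 cl dec fa.
apply/eqP; rewrite -subr_eq0; apply/eqP/inner_le0_eq0.
have fxa : f (x k) @[k --> \oo] --> f a.
  by apply: (cvg_comp _ _ xa); exact: C1_continuous.
have rhs : (f (x k) - f a) / (beta * c) @[k --> \oo] --> (f a - f a) / (beta * c).
  by apply: cvgMr_tmp; apply: cvgB => //; exact: cvg_cst.
have := ler_cvg_to (cvg_inner da da) rhs; rewrite subrr mul0r; apply.
apply: nearW => k; rewrite ler_pdivlMr ?mulr_gt0// mulrC.
have := dec k; have := fa k; rewrite enorm_sqr => fak deck.
have : beta * c * inner (d k) (d k) <= beta * lambda k * inner (d k) (d k).
  by rewrite ler_wpM2r ?inner_ge0// ler_pM2l.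
lra.
Qed.

(** A failed test at vanishing stepsizes bounds the directional derivative at
    the limit from below by - beta |d(a)|^2, while the descent property bounds
    it from above by - alpha |d(a)|^2. *)
Lemma fixed_of_failed_decrease : beta < alpha ->
  (forall k, 0 < lambda k <= 1) -> lambda @ \oo --> (0 : R) ->
  (forall k, f (x k) - beta * lambda k * enorm (d k) ^+ 2
     < f (x k + lambda k *: d k)) ->
  y a = a.
Proof.
move=> beta_alpha l01 l0 fail.
have Ddiff v : D v -> differentiable f v.
  by have [U [_ DU fU _]] := f_C1 => /DU Uv; apply: fU; rewrite inE.
have mv k : exists c, 0 <= c <= 1 /\ - beta * inner (d k) (d k)
    < inner (grad f (x k + (c * lambda k) *: d k)) (d k).
  have /andP[lk0 lk1] := l01 k.
  have [t /andP[t0 t1]|c c01 fE] := @mean_value_grad _ _ f (x k) (lambda k *: d k).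
    apply: Ddiff; rewrite scalerA; apply: segment_in_convex => //.
      exact: y_map_in.
    by rewrite mulr_ge0 ?(ltW lk0)//= mulr_ile1// ltW.
  exists c; split => //; have := fail k.
  have -> : f (x k + lambda k *: d k) = f (x k) +
      lambda k * inner (grad f (x k + (c * lambda k) *: d k)) (d k).
    by rewrite -innerZr -scalerA -fE addrCA subrr addr0.
  rewrite enorm_sqr => fail_k; rewrite -(ltr_pM2l lk0); lra.
have [c cP] := choice mv.
have cl0 : c k * lambda k @[k --> \oo] --> (0 : R).
  apply: (squeeze_cvgr (f := fun=> 0) (h := lambda)) l0; last exact: cvg_cst.
  apply: nearW => k; have [/andP[c0 c1] _] := cP k.
  have /andP[lk0 lk1] := l01 k.
  by rewrite mulr_ge0 ?(ltW lk0)//= ler_piMl// ltW.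
have xia : x k + (c k * lambda k) *: d k @[k --> \oo] --> a.
  rewrite -[X in _ --> X]addr0 -(scale0r (y a - a)).
  by apply: cvgD => //; exact: cvgZ cl0 da.
have ga : grad f (x k + (c k * lambda k) *: d k) @[k --> \oo] --> grad f a.
  by apply: (cvg_comp _ _ xia); exact: C1_grad_continuous.
have limit : - beta * inner (y a - a) (y a - a) <= inner (grad f a) (y a - a).
  have lhs : - beta * inner (d k) (d k) @[k --> \oo] -->
      - beta * inner (y a - a) (y a - a).
    by apply: cvgMl_tmp; exact: cvg_inner.
  apply: ler_cvg_to lhs (cvg_inner ga da) _.
  by apply: nearW => k; have [_ /ltW] := cP k.
apply/eqP; rewrite -subr_eq0; apply/eqP/inner_le0_eq0.
have := y_map_descent Da => desc.
rewrite -(pmulr_rle0 _ (x := alpha - beta)) ?subr_gt0//; lra.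
Qed.

End ProjectedGradientMap.

(** * Strictly increasing index sequences *)

Lemma increasing_seq_ge (phi : nat -> nat) : increasing_seq phi ->
  forall j, (j <= phi j)%N.
Proof.
move=> /increasing_seqP phi_lt; elim=> // j IH.
exact: leq_ltn_trans IH (phi_lt j).
Qed.

Lemma increasing_seq_cvg (phi : nat -> nat) : increasing_seq phi ->
  phi @ \oo --> \oo.
Proof.
move=> phi_inc A [N _ NA]; exists N => // j /= Nj.
exact/NA/(leq_trans Nj)/increasing_seq_ge.
Qed.

Lemma update_recordP {R : realType} {n : nat} (f : 'rV[R]_n -> R) u x :
  f (update_record f u x) <= f x /\
  (update_record f u x = u \/ update_record f u x = x).
Proof.
by rewrite /update_record; case: ltP => fxu; split=> //; [right|left].
Qed.

(** * Runs of the method *)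

Section Run.
Context {R : realType} {n : nat} (D : set 'rV[R]_n) (f : 'rV[R]_n -> R).
Context (gamma alpha beta : R) (tau : nat -> R).
Hypotheses (D_nonempty : D !=set0) (D_closed : closed D).
Hypothesis D_convex : convex_set (D : set (convex_lmodType 'rV[R]_n)).
Hypothesis f_C1 : continuously_differentiable_on D f.
Hypothesis sublevel_bounded : bounded_set (sublevel D f gamma).
Hypotheses (alpha_gt0 : 0 < alpha) (beta_gt0 : 0 < beta).
Hypothesis beta_lt_alpha : beta < alpha.
Hypothesis tau_itv : forall l, 0 < tau l < 1.
Hypothesis tau_cvg : tau @ \oo --> (0 : R).
Local Notation y := (y_map D f alpha).

Definition trial_point (st : gpms_state R n) :=
  iterate st + stepsize st *: (y (iterate st) - iterate st).

Definition decrease_test (st : gpms_state R n) :=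
  f (trial_point st) <= f (iterate st)
    - beta * stepsize st * enorm (y (iterate st) - iterate st) ^+ 2.

Definition state_invariant (st : gpms_state R n) :=
  [/\ sublevel D f gamma (iterate st), sublevel D f gamma (record_pt st),
      f (record_pt st) <= f (iterate st)
    & 0 < stepsize st <= tau (level st)].

Lemma init_invariant st : gpms_init D f gamma tau st -> state_invariant st.
Proof.
by move=> [Dx xu l0 lam]; split=> //; rewrite ?xu ?l0.
Qed.

Lemma trial_in st : state_invariant st -> D (trial_point st).
Proof.
move=> [[Dx _] _ _ /andP[l0 lt]]; apply: segment_in_convex => //.
  exact: y_map_in.
have /andP[_ t1] := tau_itv (level st).
by rewrite (ltW l0) (le_trans lt)// ltW.
Qed.

Lemma decrease_test_le st : state_invariant st -> decrease_test st ->
  f (trial_point st) <= f (iterate st).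
Proof.
move=> [_ _ _ /andP[l0 _]] /le_trans; apply.
by rewrite gerBl !mulr_ge0 ?exprn_ge0 ?sqrtr_ge0// ltW.
Qed.

Lemma step_invariant st st' : gpms_step D f gamma alpha beta tau st st' ->
  state_invariant st -> state_invariant st'.
Proof.
move=> [_]; rewrite -/(trial_point st) -/(decrease_test st) => step inv.
have [Sx Su fux /andP[l0 lt]] := inv.
have [fr rE] := update_recordP f (record_pt st) (trial_point st).
have Dz := trial_in inv.
move: step; case: ifP => [pass|fail].
  have Sz : sublevel D f gamma (trial_point st).
    by split=> //; apply: le_trans (decrease_test_le inv pass) Sx.2.
  move=> [/andP[ll lt'] lE xE uE]; split; rewrite ?xE ?uE//.
    by case: rE => ->.
  by rewrite (lt_le_trans l0 ll) lE.
move=> [/andP[l0' ll'] lE].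
have lam' : 0 < stepsize st' <= tau (level st').
  by rewrite l0' lE (le_trans ll')// ge_min lexx orbT.
case: ifP => [fz [xE uE]|_ [xE uE]]; split; rewrite ?xE ?uE//.
by case: rE => ->.
Qed.

Context (s : nat -> gpms_state R n).
Hypothesis run : gpms_infinite_run D f gamma alpha beta tau s.
Local Notation x := (fun k => iterate (s k)).

Lemma run_invariant k : state_invariant (s k).
Proof.
have [init step] := run; elim: k => [|k]; first exact: init_invariant.
exact: step_invariant.
Qed.

Let Dx k : D (x k). Proof. by have [[]] := run_invariant k. Qed.

Lemma run_bounded : bounded_set (range x).
Proof.
case: sublevel_bounded => M [Mr HM]; exists M; split => // M' MM' _ [k _ <-].
by apply: (HM M' MM'); have [] := run_invariant k.
Qed.

Lemma run_pass k : decrease_test (s k) ->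
  [/\ x k.+1 = trial_point (s k), stepsize (s k) <= stepsize (s k.+1)
    & level (s k.+1) = level (s k)].
Proof.
by move=> pass; have [_] := run.2 k; rewrite ifT// => -[/andP[]].
Qed.

(** After a failure the two kinds of next iterate are only distinguished as far
    as the value of [f] needs it: a restart from the record point does not
    increase [f]. *)
Lemma run_fail k : ~~ decrease_test (s k) ->
  level (s k.+1) = (level (s k)).+1 /\
  (x k.+1 = trial_point (s k) \/ f (x k.+1) <= f (x k)).
Proof.
move=> /negbTE fail; have [_] := run.2 k; rewrite ifF// => -[_ lE].
have [_ _ fux _] := run_invariant k.
by case: ifP => _ [xE _]; split=> //; [left|right; rewrite xE].
Qed.

Lemma run_level_nondecreasing i j : (i <= j)%N ->
  (level (s i) <= level (s j))%N.
Proof.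
apply: (@homo_leq _ (fun k => level (s k)) leq leqnn leq_trans) => k.
have [/run_pass[_ _ ->]//|/run_fail[-> _]] := boolP (decrease_test (s k)).
exact: leqnSn.
Qed.

(** Each failure raises the level, and the stepsize never exceeds [tau] at the
    current level. *)
Lemma run_stepsize_cvg0 :
  (forall N, exists2 k, (N <= k)%N & ~~ decrease_test (s k)) ->
  stepsize (s k) @[k --> \oo] --> (0 : R).
Proof.
move=> failinf.
have lev_unbounded L : exists k, (L <= level (s k))%N.
  elim: L => [|L [k Lk]]; first by exists 0%N.
  have [k' kk' /run_fail[lE _]] := failinf k; exists k'.+1; rewrite lE ltnS.
  exact: leq_trans Lk (run_level_nondecreasing kk').
have lev_cvg : level (s k) @[k --> \oo] --> \oo.
  move=> A [L _ LA]; have [N LN] := lev_unbounded L.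
  by exists N => // k /= Nk; exact/LA/(leq_trans LN)/run_level_nondecreasing.
have tau_lev : tau (level (s k)) @[k --> \oo] --> (0 : R).
  exact: cvg_comp lev_cvg tau_cvg.
apply: squeeze_cvgr (cvg_cst _) tau_lev.
by apply: nearW => k; have [_ _ _ /andP[/ltW -> ->]] := run_invariant k.
Qed.

Lemma trial_cvg (phi : nat -> nat) (a : 'rV[R]_n) :
  x \o phi @ \oo --> a -> stepsize (s (phi k)) @[k --> \oo] --> (0 : R) ->
  trial_point (s (phi j)) @[j --> \oo] --> a.
Proof.
move=> xa l0.
have Da : D a by apply: (closed_cvg D D_closed _ _ xa); apply: nearW => j; exact: Dx.
have ya : y (x (phi j)) @[j --> \oo] --> y a.
  by apply: (cvg_comp _ _ xa); exact: y_map_continuous.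
rewrite -[X in _ --> X]addr0 -(scale0r (y a - a)).
exact: (cvgD xa (cvgZ l0 (cvgB ya xa))).
Qed.

(** The extra condition [Q] lets the same extraction serve both for finding a
    stationary limit point and for refuting infinitely many failures followed
    by a large value of [f]. *)
Lemma failing_subsequence (Q : set nat) :
  (forall N, exists2 k, (N <= k)%N & ~~ decrease_test (s k) /\ Q k) ->
  exists (a : 'rV[R]_n) (phi : nat -> nat),
    [/\ increasing_seq phi, forall j, ~~ decrease_test (s (phi j)) /\ Q (phi j),
        x \o phi @ \oo --> a, trial_point (s (phi j)) @[j --> \oo] --> a
      & stationary D f a].
Proof.
move=> failQ.
have [|a [phi [phi_inc phiP xa]]] := bounded_subsequence run_bounded (P := fun k =>
    ~~ decrease_test (s k) /\ Q k).
  by move=> N; have [k] := failQ N; exists k.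
have l0 : stepsize (s (phi k)) @[k --> \oo] --> (0 : R).
  have lam0 : stepsize (s k) @[k --> \oo] --> (0 : R).
    by apply: run_stepsize_cvg0 => N; have [k Nk []] := failQ N; exists k.
  exact: cvg_comp (increasing_seq_cvg phi_inc) lam0.
have Da : D a by apply: (closed_cvg D D_closed _ _ xa); apply: nearW => j; exact: Dx.
exists a, phi; split=> //; first exact: trial_cvg.
apply: (y_map_fixed_stationary D_nonempty D_closed D_convex alpha_gt0) => //.
have lam01 j : 0 < stepsize (s (phi j)) <= 1.
  have [_ _ _ /andP[-> lt]] := run_invariant (phi j).
  by have /andP[_ /ltW t1] := tau_itv (level (s (phi j))); rewrite (le_trans lt).
have fail j : f (x (phi j)) - beta * stepsize (s (phi j)) *
    enorm (y (x (phi j)) - x (phi j)) ^+ 2 < f (trial_point (s (phi j))).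
  by rewrite ltNge; exact: (phiP j).1.
exact: (fixed_of_failed_decrease D_nonempty D_closed D_convex f_C1 alpha_gt0
  (fun j => Dx (phi j)) xa beta_lt_alpha lam01 l0 fail).
Qed.

(** From [N] on, [f] does not increase along the iterates, so its values stay
    above the limit f(a) of a subsequence, and the stepsizes stay above the one
    at [N]. *)
Lemma passing_limit_stationary N phi (a : 'rV[R]_n) :
  (forall k, (N <= k)%N -> decrease_test (s k)) ->
  increasing_seq phi -> x \o phi @ \oo --> a -> stationary D f a.
Proof.
move=> pass phi_inc xa.
have Da : D a by apply: (closed_cvg D D_closed _ _ xa); apply: nearW => j; exact: Dx.
have fxa : f (x (phi j)) @[j --> \oo] --> f a.
  by apply: (cvg_comp _ _ xa); exact: (C1_continuous f_C1).
have lam_ge k : (N <= k)%N -> stepsize (s N) <= stepsize (s k).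
  elim: k => [|k IH]; first by rewrite leqn0 => /eqP ->.
  rewrite leq_eqVlt ltnS => /predU1P[->//|Nk].
  by have [_ + _] := run_pass (pass k Nk); exact: le_trans (IH Nk).
have f_noninc i j : (N <= i)%N -> (i <= j)%N -> f (x j) <= f (x i).
  move=> Ni; elim: j => [|j IH]; first by rewrite leqn0 => /eqP ->.
  rewrite leq_eqVlt ltnS => /predU1P[->//|ij]; apply: le_trans (IH ij).
  have passj := pass j (leq_trans Ni ij); have [-> _ _] := run_pass passj.
  exact: decrease_test_le (run_invariant j) passj.
have fa k : (N <= k)%N -> f a <= f (x k).
  move=> Nk; apply: cvgr_to_le fxa _; exists k => // j /= kj.
  exact: f_noninc Nk (leq_trans kj (increasing_seq_ge phi_inc j)).
(* The shift by [N] moves the whole subsequence past the last failure. *)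
pose psi j := phi (j + N)%N.
have N_psi j : (N <= psi j)%N.
  exact: leq_trans (leq_addl _ _) (increasing_seq_ge phi_inc _).
have xpsi : x \o psi @ \oo --> a.
  by move: xa; rewrite -(cvg_shiftn N).
have lamN0 : 0 < stepsize (s N) by have [_ _ _ /andP[]] := run_invariant N.
have fa_trial j : f a <= f (trial_point (s (psi j))).
  have [<- _ _] := run_pass (pass _ (N_psi j)).
  exact: fa (leqW (N_psi j)).
apply: (y_map_fixed_stationary D_nonempty D_closed D_convex alpha_gt0) => //.
exact: (fixed_of_sufficient_decrease D_nonempty D_closed D_convex f_C1
  (fun j => Dx (psi j)) xpsi beta_gt0 lamN0 (fun j => lam_ge _ (N_psi j))
  (fun j => pass _ (N_psi j)) fa_trial).
Qed.

Lemma run_stationary_limit_point :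
  exists a, seq_limit_point x a /\ stationary D f a.
Proof.
have [failinf|] := pselect (forall N, exists2 k, (N <= k)%N & ~~ decrease_test (s k)).
  have [|a [phi [phi_inc _ xa _ Sa]]] := @failing_subsequence setT.
    by move=> N; have [k Nk ?] := failinf N; exists k.
  by exists a; split=> //; exists phi.
move=> /existsNP[N passN].
have pass k : (N <= k)%N -> decrease_test (s k).
  by move=> Nk; apply/negPn/negP => fail; apply: passN; exists k.
have [|a [phi [phi_inc _ xa]]] := bounded_subsequence run_bounded (P := setT).
  by move=> M; exists M.
exists a; split; first by exists phi.
exact: passing_limit_stationary pass phi_inc xa.
Qed.

(** Values below [m + e] persist through successful tests, because these do not
    increase [f], and through late failures, because those are followed by
    values below [m + e]; a stationary limit point provides a first one. *)
Lemma run_value_cvg m :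
  (forall a, stationary D f a -> f a = m) -> (forall v, D v -> m <= f v) ->
  f (x k) @[k --> \oo] --> m.
Proof.
move=> statm mf.
have fcvg phi a (v : nat -> 'rV[R]_n) : stationary D f a ->
    v \o phi @ \oo --> a -> f (v (phi j)) @[j --> \oo] --> m.
  move=> Sa va; rewrite -(statm a Sa).
  by apply: (cvg_comp _ _ va); apply: (C1_continuous f_C1); exact: Sa.1.
suff small e : 0 < e -> exists N, forall k, (N <= k)%N -> f (x k) < m + e.
  apply/cvgrPdist_lt => e e0; have [N Ne] := small e e0.
  exists N => // k /= Nk; have := Ne k Nk; have := mf _ (Dx k).
  by move=> ? ?; rewrite distrC ger0_norm; lra.
move=> e0; have me : m < m + e by rewrite ltrDl.
have [N failN] : exists N, forall k, (N <= k)%N -> ~~ decrease_test (s k) ->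
    f (x k.+1) < m + e.
  apply: contrapT => /forallNP noN.
  have [|a [phi [_ phiP xa za Sa]]] := @failing_subsequence [set k | m + e <= f (x k.+1)].
    move=> N; have /existsNP[k /not_implyP[Nk /not_implyP[fail]]] := noN N.
    by move=> /negP; rewrite -leNgt => ?; exists k.
  have fx := fcvg phi a x Sa xa.
  have fz := fcvg phi a (trial_point \o s) Sa za.
  have [j [fxj fzj]] := filter_ex (filterI (cvgr_lt m fx _ me) (cvgr_lt m fz _ me)).
  have [fail big] := phiP j; have [_ []] := run_fail fail => [xE|fle].
    by move: big fzj; rewrite /= xE => /le_lt_trans/[apply]; rewrite ltxx.
  by move: (le_trans big fle) fxj => /le_lt_trans/[apply]; rewrite ltxx.
have [a [[phi phi_inc xa] Sa]] := run_stationary_limit_point.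
have [j [fj Nj]] := filter_ex (filterI (cvgr_lt m (fcvg phi a x Sa xa) _ me)
  (nbhs_infty_ge N)).
have Nphi : (N <= phi j)%N := leq_trans Nj (increasing_seq_ge phi_inc j).
exists (phi j); elim=> [|k IH]; first by rewrite leqn0 => /eqP <-.
rewrite leq_eqVlt ltnS => /predU1P[<-//|jk].
have [pass|fail] := boolP (decrease_test (s k)).
  have [-> _ _] := run_pass pass.
  exact: le_lt_trans (decrease_test_le (run_invariant k) pass) (IH jk).
exact: failN (leq_trans Nphi jk) fail.
Qed.

Lemma run_minimizing : minimizers D f = stationary D f ->
  (forall a, seq_limit_point x a -> minimizers D f a) /\
  (f (x k))%:E @[k --> \oo] --> inf_val D f.
Proof.
move=> DD.
have [a0 [_ Sa0]] := run_stationary_limit_point.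
have [_ infE] : minimizers D f a0 by rewrite DD.
have fm : f (x k) @[k --> \oo] --> f a0.
  apply: run_value_cvg => [a Sa|v Dv].
    have [_ infEa] : minimizers D f a by rewrite DD.
    by apply: EFin_inj; rewrite infE infEa.
  by rewrite -lee_fin infE; apply: ereal_inf_lbound; exists v.
rewrite -infE; split=> [a [phi phi_inc xa]|]; last first.
  by apply: cvg_EFin => //; exact: nearW.
have Da : D a by apply: (closed_cvg D D_closed _ _ xa); apply: nearW => j; exact: Dx.
split=> //; rewrite -infE; congr EFin.
have fa : f (x (phi j)) @[j --> \oo] --> f a.
  by apply: (cvg_comp _ _ xa); exact: (C1_continuous f_C1).
apply: cvg_unique fa _; first exact: Rhausdorff.
exact: cvg_comp (increasing_seq_cvg phi_inc) fm.
Qed.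

End Run.

Unset Implicit Arguments.
Set Strict Implicit.
Set Printing Implicit Defensive.

(** * Convergence of the method *)

Theorem theorem2 (R : realType) (n : nat) (D : set 'rV[R]_n)
    (f : 'rV[R]_n -> R) (gamma alpha beta : R) (tau : nat -> R)
    (D_nonempty : D !=set0)
    (D_convex : convex_set (D : set (convex_lmodType 'rV[R]_n)))
    (D_closed : closed D)
    (f_C1 : continuously_differentiable_on D f)
    (gamma_gt : (inf_val D f < gamma%:E)%E)
    (sublevel_bounded : bounded_set (sublevel D f gamma))
    (alpha_gt0 : 0 < alpha)
    (beta_gt0 : 0 < beta) (beta_lt1 : beta < 1) (beta_lt_alpha : beta < alpha)
    (tau_itv : forall l, 0 < tau l < 1)
    (tau_cvg : tau @ \oo --> (0 : R)) :
  [/\ forall (s : nat -> gpms_state R n) (k : nat),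
        gpms_terminates_at D f gamma alpha beta tau s k ->
        stationary D f (iterate (s k)),
      forall s : nat -> gpms_state R n,
        gpms_infinite_run D f gamma alpha beta tau s ->
        exists a, seq_limit_point (fun k => iterate (s k)) a /\
                  stationary D f a
    & forall s : nat -> gpms_state R n,
        gpms_infinite_run D f gamma alpha beta tau s ->
        minimizers D f = stationary D f ->
        (forall a, seq_limit_point (fun k => iterate (s k)) a ->
                   minimizers D f a) /\
        (f (iterate (s k)))%:E @[k --> \oo] --> inf_val D f].
Proof.
split.
- move=> s k [init step fixed].
  apply: (y_map_fixed_stationary D_nonempty D_closed D_convex alpha_gt0) => //.
  suff inv i : (i <= k)%N -> state_invariant D f gamma tau (s i).
    by have [[]] := inv k (leqnn k).
  elim: i => [_|i IH ik]; first exact: init_invariant.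
  by apply: (step_invariant D_nonempty D_closed D_convex beta_gt0 tau_itv (step i ik));
    exact: IH (ltnW ik).
- move=> s run.
  exact: (run_stationary_limit_point D_nonempty D_closed D_convex f_C1
    sublevel_bounded alpha_gt0 beta_gt0 beta_lt_alpha tau_itv tau_cvg run).
- move=> s run.
  exact: (run_minimizing D_nonempty D_closed D_convex f_C1
    sublevel_bounded alpha_gt0 beta_gt0 beta_lt_alpha tau_itv tau_cvg run).
Qed.
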